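(* Let $\mathfrak{g}$ be a finite-dimensional quadratic Lie algebra over an algebraically closed field $k$ of characteristic zero. Then $\mathfrak{g}$ is coregular if one of the following conditions is satisfied: (i) $[\mathfrak{g},\mathfrak{g}]\neq\mathfrak{g}$ and $i(\mathfrak{g})=2$; (ii) $\mathfrak{g}$ is nilpotent and $i(\mathfrak{g})=3$.
   Context: $\mathfrak{g}$ is quadratic if it admits a nondegenerate, symmetric, invariant bilinear form $b$ (i.e. $b([x,y],z)=b(x,[y,z])$ for all $x,y,z$). The index is $i(\mathfrak{g})=\min_{\xi\in\mathfrak{g}^*}\dim\{x\in\mathfrak{g}\mid\xi([x,y])=0\ \forall y\in\mathfrak{g}\}$. $\mathfrak{g}$ is coregular if $Y(\mathfrak{g})=S(\mathfrak{g})^{\mathfrak{g}}$ (invariants of the adjoint action on the symmetric algebra) is a polynomial algebra over $k$. *)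

(* Defs.v *)
From HB Require Import structures.
From mathcomp Require Import all_boot all_algebra.
From mathcomp Require Import sesquilinear.
From mathcomp Require Import boolp.
From mathcomp Require Import mpoly.

Set Implicit Arguments.
Unset Strict Implicit.
Unset Printing Implicit Defensive.

Import GRing.Theory.
Local Open Scope ring_scope.

HB.mixin Record Vector_isLie (k : fieldType) g of Vector k g := {
  lie : {bilinear g -> g -> g};
  liexx : forall x, lie x x = 0;
  lie_jacobi : forall x y z,
    lie x (lie y z) + lie y (lie z x) + lie z (lie x y) = 0
}.

#[short(type="lieAlgType")]
HB.structure Definition LieAlg (k : fieldType) :=
  { g of Vector k g & Vector_isLie k g }.

Section LieAlgebra.
Variables (k : fieldType) (g : lieAlgType k).

(* [U, V], the span of all brackets: bases suffice, see memv_lie and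
   lie_prodP. *)
Definition lie_prod (U V : {vspace g}) : {vspace g} :=
  <<[seq lie u v | u <- vbasis U, v <- vbasis V]>>%VS.

Lemma memv_lie (U V : {vspace g}) u v :
  u \in U -> v \in V -> lie u v \in lie_prod U V.
Proof.
move=> /coord_vbasis-> /coord_vbasis->.
rewrite linear_sumr; apply: memv_suml => j _.
rewrite linear_sumlz; apply: memv_suml => i _.
rewrite linearZl_LR linearZr_LR !memvZ //.
by apply/memv_span/allpairs_f; rewrite mem_nth ?size_tuple.
Qed.

Lemma lie_prodP (U V W : {vspace g}) :
  reflect (forall u v, u \in U -> v \in V -> lie u v \in W)
          (lie_prod U V <= W)%VS.
Proof.
apply: (iffP idP) => [sUVW u v Uu Vv | sUVW].
  exact/(subvP sUVW)/memv_lie.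
apply/span_subvP=> _ /allpairsP[[u v] /= [Uu Vv ->]].
by rewrite sUVW ?vbasis_mem.
Qed.

Definition lower_central (i : nat) : {vspace g} := iter i (lie_prod fullv) fullv.

Definition lie_nilpotent : Prop := exists i, lower_central i = 0%VS.

(* sesquilinear.nondegenerate b says that the radical of b is zero. *)
Definition quadratic : Prop :=
  exists2 b : {symmetric g}, nondegenerate b
    & forall x y z, b (lie x y) z = b x (lie y z).

(* { x | xi [x, y] = 0 for all y }, as the kernel of x |-> xi [x, -]. *)
Definition lie_stab (xi : 'Hom(g, k^o)) : {vspace g} :=
  lker (linfun (fun x : g => linfun (fun y : g => xi (lie x y)))).

Lemma lie_stabP (xi : 'Hom(g, k^o)) x :
  x \in lie_stab xi <-> forall y, xi (lie x y) = 0.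
Proof.
have lin2 u : linear (fun y : g => xi (lie u y)).
  by move=> a y z; rewrite linearPr linearP.
pose f2 u : {linear g -> k^o} :=
  HB.pack (fun y : g => xi (lie u y))
    (GRing.isLinear.Build k g k^o *:%R _ (lin2 u)).
have f2E u y : linfun (fun y : g => xi (lie u y)) y = xi (lie u y).
  exact: (lfunE (f2 u)).
have lin1 : linear (fun x : g => linfun (fun y : g => xi (lie x y))).
  move=> a u v; apply/lfunP=> y.
  by rewrite add_lfunE scale_lfunE !f2E linearPl linearP.
pose f1 : {linear g -> 'Hom(g, k^o)} :=
  HB.pack (fun x : g => linfun (fun y : g => xi (lie x y)))
    (GRing.isLinear.Build k g _ *:%R _ lin1).
rewrite memv_ker (lfunE f1) /=; split=> [/eqP/lfunP h y | h].
  by rewrite -f2E h lfunE.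
by apply/eqP/lfunP=> y; rewrite f2E h lfunE.
Qed.

Lemma lie_stab_dim_exists :
  exists n, `[< exists xi : 'Hom(g, k^o), \dim (lie_stab xi) = n >].
Proof. by exists (\dim (lie_stab 0)); apply/asboolP; exists 0. Qed.

Definition lie_index : nat := ex_minn lie_stab_dim_exists.

(* The symmetric algebra S(g), as the polynomials in a basis of g; sym_inj is
   the inclusion of g, and sym_univ the universal property. *)
Local Notation n := (\dim {:g}).
Local Notation e := (vbasis {:g}).
Local Notation Sg := {mpoly k[n]}.

Definition sym_inj (x : g) : Sg := \sum_(i < n) coord e i x *: 'X_i.

(* The adjoint action of x on S(g): the derivation extending
   y |-> [x, y], see sym_ad_inj and sym_adM. *)
Definition sym_ad (x : g) (p : Sg) : Sg :=
  \sum_(i < n) sym_inj (lie x e`_i) * p^`M(i).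

(* Y(g) = S(g)^g *)
Definition sym_invariant (p : Sg) : Prop := forall x, sym_ad x p = 0.

(* Y(g) is the image of an injective algebra morphism from a polynomial ring.
   Finitely many variables suffice: their number is at most the transcendence
   degree \dim {:g} of S(g). *)
Definition coregular : Prop :=
  exists m (phi : {lrmorphism {mpoly k[m]} -> Sg}),
    injective phi /\ forall p, sym_invariant p <-> exists q, phi q = p.

Lemma sym_inj_is_linear : linear sym_inj.
Proof.
move=> a x y; rewrite /sym_inj scaler_sumr -big_split /=.
by apply: eq_bigr => i _; rewrite linearP scalerDl scalerA.
Qed.
HB.instance Definition _ :=
  GRing.isLinear.Build k g Sg *:%R sym_inj sym_inj_is_linear.

Lemma sym_inj_basis (i : 'I_n) : sym_inj e`_i = 'X_i.
Proof.
have fe : free e := basis_free (vbasisP _).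
rewrite /sym_inj (bigD1 i) //= coord_free // eqxx scale1r big1 ?addr0 //.
by move=> j /negPf jNi; rewrite coord_free // eq_sym jNi scale0r.
Qed.

Lemma sym_univ (A : comAlgType k) (f : {linear g -> A}) :
  exists phi : {lrmorphism Sg -> A}, (forall x, phi (sym_inj x) = f x) /\
    forall psi : {lrmorphism Sg -> A},
      (forall x, psi (sym_inj x) = f x) -> psi =1 phi.
Proof.
pose h (i : 'I_n) : A := f e`_i.
have hZ : scalable (mmap (GRing.in_alg A) h).
  by move=> c p; rewrite /= mmapZ /= mulr_algl.
pose phi : {lrmorphism Sg -> A} :=
  HB.pack (mmap (GRing.in_alg A) h)
    (GRing.RMorphism.on (mmap (GRing.in_alg A) h))
    (GRing.isScalable.Build k Sg A *:%R _ hZ).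
have phi_inj x : phi (sym_inj x) = f x.
  rewrite [in RHS](coord_vbasis (memvf x)) /sym_inj !linear_sum.
  apply: eq_bigr => i _; rewrite !linearZ; congr (_ *: _).
  by rewrite /= mmapX mmap1U.
exists phi; split=> // psi psi_inj; elim/mpolyind => [|c m p _ _ IHp].
  by rewrite !linear0.
rewrite (linearP psi) (linearP phi); congr (_ *: _ + _); last exact: IHp.
rewrite mpolyXE_id (rmorph_prod psi) (rmorph_prod phi); apply: eq_bigr => i _.
rewrite (rmorphXn psi) (rmorphXn phi) -sym_inj_basis; congr (_ ^+ _).
exact: (etrans (psi_inj _) (esym (phi_inj _))).
Qed.

Lemma sym_ad_is_linear x : linear (sym_ad x).
Proof.
move=> a p q; rewrite /sym_ad scaler_sumr -big_split /=.
by apply: eq_bigr => i _; rewrite linearP mulrDr scalerAr.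
Qed.

Lemma sym_adM x p q : sym_ad x (p * q) = sym_ad x p * q + p * sym_ad x q.
Proof.
rewrite /sym_ad mulr_suml mulr_sumr -big_split /=; apply: eq_bigr => i _.
rewrite mderivM mulrDr; congr (_ + _); [exact: mulrA | exact: mulrCA].
Qed.

Lemma sym_ad_inj x y : sym_ad x (sym_inj y) = sym_inj (lie x y).
Proof.
rewrite [in RHS](coord_vbasis (memvf y)) linear_sumr linear_sum /sym_ad.
apply: eq_bigr => i _.
have -> : (sym_inj y)^`M(i) = (coord e i y)%:MP.
  rewrite /sym_inj linear_sum (bigD1 i) //= big1 => [|j /negPf jNi].
    rewrite addr0 linearZ /= mderivX mnm1E eqxx scale1r.
    by rewrite -{1}[U_(i)%MM]add0m addmK mpolyX0 -mul_mpolyC mulr1.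
  by rewrite linearZ /= mderivX mnm1E jNi scale0r scaler0.
by rewrite linearZr_LR linearZ mulrC mul_mpolyC.
Qed.

End LieAlgebra.

(* Main.v *)
(* Write i(g) = r + 1 and n = dim g. In both cases [g, g] has codimension at
   least r, so its orthogonal for b contains r independent central elements
   z_1, ..., z_r; unless g is abelian, n >= r + 2. For an invariant f, the
   gradients of f, of the Casimir element c and of the z_i all lie in the kernel
   of the matrix ([e_i, e_j]) over Frac S(g), which has dimension i(g). Hence
   grad f is proportional to grad c modulo the z_i, and as the derivatives of c
   are linear forms, at least two of which remain independent modulo the z_i,
   the ratio is a polynomial. Integrating it in c, by induction on the degree,
   gives S(g)^g = k[z_1, ..., z_r, c]. *)
From HB Require Import structures.
Require Import Defs.
From mathcomp Require Import all_boot all_algebra.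
From mathcomp Require Import sesquilinear boolp mpoly ring.

Set Implicit Arguments.
Unset Strict Implicit.
Unset Printing Implicit Defensive.

Import GRing.Theory.
Local Open Scope ring_scope.

(** * Derivatives, linear forms and substitutions in polynomial rings *)

Section Polynomials.
Variable k : fieldType.

Lemma mpoly_ring_ind n (P : {mpoly k[n]} -> Prop) :
    (forall c, P c%:MP) -> (forall i, P 'X_i) ->
    (forall p q, P p -> P q -> P (p + q)) ->
    (forall p q, P p -> P q -> P (p * q)) ->
  forall p, P p.
Proof.
move=> PC PX PD PM; have P1 : P 1 by rewrite -mpolyC1.
elim/mpolyind=> [|c m p _ _ IHp]; first by rewrite -mpolyC0.
apply: (PD) => //; rewrite -mul_mpolyC; apply: (PM) => //.
rewrite mpolyXE_id; apply: big_ind => // i _.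
by elim: (m i) => [|d IHd]; rewrite ?expr0 // exprS; apply: (PM).
Qed.

Lemma lrmorph_mpolyC n (A : algType k) (phi : {lrmorphism {mpoly k[n]} -> A}) c :
  phi c%:MP = c%:A.
Proof. by rewrite -[c%:MP]mulr1 mul_mpolyC linearZ /= rmorph1. Qed.

Lemma mderivXU n (i j : 'I_n) : ('X_i : {mpoly k[n]})^`M(j) = (i == j)%:R.
Proof.
rewrite mderivX mnm1E; case: eqP => [->|_]; last by rewrite scale0r.
by rewrite scale1r -{1}[U_(j)%MM]add0m addmK mpolyX0.
Qed.

(** Both sides are additive and obey the Leibniz rule in [p], so comparing them on constants and
    variables suffices. It serves for partial derivatives and for [sym_ad x] alike. *)
Lemma chain_rule n (A : comAlgType k) (phi : {lrmorphism {mpoly k[n]} -> A})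
    (D : {linear A -> A}) p :
  (forall x y, D (x * y) = D x * y + x * D y) ->
  D (phi p) = \sum_i phi (p^`M(i)) * D (phi 'X_i).
Proof.
move=> DM; have D1 : D 1 = 0.
  apply: (addrI (D 1)); rewrite addr0.
  by rewrite -[in RHS](mulr1 1) DM mulr1 mul1r.
elim/mpoly_ring_ind: p => [c|i|p q IHp IHq|p q IHp IHq].
- rewrite lrmorph_mpolyC linearZ /= D1 scaler0 big1 // => i _.
  by rewrite mderivC rmorph0 mul0r.
- rewrite (bigD1 i) //= mderivXU eqxx rmorph1 mul1r big1 ?addr0 // => j.
  by rewrite eq_sym => /negPf ji; rewrite mderivXU ji rmorph0 mul0r.
- rewrite !raddfD /= IHp IHq -big_split; apply: eq_bigr => i _.
  by rewrite !raddfD mulrDl.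
rewrite rmorphM DM IHp IHq mulr_suml mulr_sumr -big_split.
apply: eq_bigr => i _; rewrite mderivM rmorphD !rmorphM /=; ring.
Qed.

Lemma comp_mpolyXE n m (F : 'I_n -> {mpoly k[m]}) i :
  'X_i \mPo [tuple F j | j < n] = F i.
Proof. by rewrite comp_mpolyXU -tnth_nth tnth_mktuple. Qed.

Lemma eq_lrmorph n (A : algType k) (phi psi : {lrmorphism {mpoly k[n]} -> A}) :
  (forall i, phi 'X_i = psi 'X_i) -> phi =1 psi.
Proof.
move=> eqX; elim/mpoly_ring_ind=> [c|i|p q IHp IHq|p q IHp IHq] //.
- by rewrite !lrmorph_mpolyC.
- by rewrite !raddfD /= IHp IHq.
by rewrite !rmorphM /= IHp IHq.
Qed.

(** The leading monomial of the derivative comes from a monomial of [p] of degree one higher. *)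
Lemma msize_mderiv n i (p : {mpoly k[n]}) :
  p^`M(i) != 0 -> (msize p^`M(i) < msize p)%N.
Proof.
move=> nz; rewrite -mlead_deg //; set m := mlead _.
have : (p^`M(i))@_m != 0 by rewrite mleadc_eq0.
rewrite mcoeff_mderiv => nzm; have {}nzm : p@_(m + U_(i)) != 0.
  by apply: contraNneq nzm => ->; rewrite mul0rn.
have := msize_mdeg_lt (p := p) (m := (m + U_(i))%MM).
by rewrite mcoeff_msupp => /(_ nzm); rewrite mdegD mdeg1 addn1.
Qed.

Definition linform n (a : 'I_n -> k) : {mpoly k[n]} := \sum_i a i *: 'X_i.

Lemma linform_eq0 n (a : 'I_n -> k) : linform a = 0 -> forall i, a i = 0.
Proof.
move=> /(congr1 (mcoeff U_(_)))E i; have := E i.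
rewrite linear_sum (bigD1 i) //= mcoeff0 mcoeffZ mcoeffX eqxx mulr1 big1 ?addr0 //.
move=> j /negPf ji; rewrite mcoeffZ mcoeffX; case: eqP => [|_]; last by rewrite mulr0.
by move=> /mnmP/(_ j); rewrite !mnm1E eqxx eq_sym ji.
Qed.

Lemma comp_linform n m (a : 'I_n -> k) (t : n.-tuple {mpoly k[m]}) :
  linform a \mPo t = \sum_i a i *: tnth t i.
Proof.
rewrite linear_sum; apply: eq_bigr => i _.
by rewrite linearZ /= comp_mpolyXU -tnth_nth.
Qed.

(* Eliminating a variable that occurs in a linear form l is reduction modulo l;
   the result is a polynomial ring again, so l is prime. *)
Lemma linform_dvd n (a b : 'I_n -> k) (p q : {mpoly k[n]}) :
  (forall s t, (forall i, s * a i + t * b i = 0) -> s = 0 /\ t = 0) ->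
  p * linform b = q * linform a -> exists h, p = h * linform a.
Proof.
move=> abfree eq_pq.
have [j aj0] : exists j, a j != 0.
  apply/existsP; apply: contraT => /existsPn a0.
  have /(_ _)[|/eqP] := abfree 1 0; last by rewrite oner_eq0.
  by move=> i; rewrite (eqP (negPn (a0 i))) mulr0 mul0r addr0.
pose F i := if i == j then 'X_j - (a j)^-1 *: linform a else 'X_i.
pose th : {mpoly k[n]} -> {mpoly k[n]} := comp_mpoly [tuple F i | i < n].
have thE u : th (linform u) = linform (fun i => u i - u j / a j * a i).
  rewrite /th comp_linform /linform (bigD1 j) //= tnth_mktuple /F eqxx.
  rewrite [RHS](bigD1 j) //= mulfVK // subrr scale0r add0r.
  rewrite {1}/linform (bigD1 j) //= [_^-1 *: _]scalerDr scalerA mulVf // scale1r opprD.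
  rewrite addrA subrr add0r scalerN scalerA -scaleNr scaler_sumr -big_split /=.
  apply: eq_bigr => i /negPf ij; rewrite tnth_mktuple ij scalerA -scalerDl.
  by rewrite mulNr addrC.
have th_mod r : exists h, r = h * linform a + th r.
  rewrite /th; elim/mpoly_ring_ind: r => [c|i|r s [h1 E1] [h2 E2]|r s [h1 E1] [h2 E2]].
  - by exists 0; rewrite mul0r add0r comp_mpolyC.
  - rewrite comp_mpolyXE /F; case: eqP => [->|_]; last by exists 0; rewrite mul0r add0r.
    by exists (a j)^-1%:MP; rewrite mul_mpolyC subrKC.
  - exists (h1 + h2); rewrite raddfD /= {1}E1 {1}E2; ring.
  exists (h1 * s + th r * h2); rewrite rmorphM /= mulrDl -addrA mulrAC.
  by rewrite -(mulrA (th r)) -mulrDr -E2 -mulrDl -E1.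
have tha : th (linform a) = 0.
  rewrite thE /linform big1 // => i _; rewrite divff // mul1r subrr scale0r //.
have [h Ep] := th_mod p; exists h.
rewrite Ep; suff -> : th p = 0 by rewrite addr0.
have /eqP : th p * th (linform b) = 0.
  by rewrite /th -rmorphM eq_pq rmorphM /= -/th tha mulr0.
rewrite mulf_eq0 => /orP[/eqP // | /eqP].
rewrite thE => /linform_eq0 b0.
(* The image of [linform b] being zero makes [b] the multiple [b j / a j] of [a], against
   independence. *)
have [|_ /eqP] := abfree (- (b j / a j)) 1; last by rewrite oner_eq0.
by move=> i; rewrite mul1r mulNr addrC b0.
Qed.

Hypothesis char0 : [pchar k] =i pred0.

Lemma natr_neq0 d : d.+1%:R != 0 :> k.
Proof. by rewrite ((pcharf0P k).1 char0). Qed.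

Lemma mcoeff_mderiv_eq0 n i (p : {mpoly k[n]}) (m : 'X_{1..n}) :
  p^`M(i) = 0 -> m i != 0%N -> p@_m = 0.
Proof.
move=> /(congr1 (mcoeff (m - U_(i))%MM)) E nz; move: E.
rewrite mcoeff_mderiv mcoeff0 submK; last first.
  by apply/mnm_lepP=> j; rewrite mnm1E; case: eqP => // <-; rewrite lt0n.
by rewrite -mulr_natr => /eqP; rewrite mulf_eq0 (negPf (natr_neq0 _)) orbF => /eqP.
Qed.

Lemma mderiv_eq0_const n (p : {mpoly k[n]}) :
  (forall i, p^`M(i) = 0) -> p = (p@_0)%:MP.
Proof.
move=> p0; apply/mpolyP=> m; rewrite mcoeffC eq_sym.
have [->|nz] := eqVneq m 0%MM; first by rewrite mulr1.
have [i mi] : exists i, m i != 0%N.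
  apply/existsP; apply: contraNT nz => /existsPn m0; apply/eqP/mnmP=> i.
  by rewrite mnm0E; apply/eqP/negPn.
by rewrite mulr0 (mcoeff_mderiv_eq0 (p0 i)).
Qed.

Lemma mpoly_antideriv n i (p : {mpoly k[n]}) : exists q, q^`M(i) = p.
Proof.
elim/mpolyind: p => [|c m p _ _ [q <-]]; first by exists 0; rewrite mderiv0.
exists ((c / (m i).+1%:R) *: 'X_[m + U_(i)] + q); rewrite mderivD mderivZ mderivX.
by rewrite addmK mnmDE mnm1E eqxx addn1 scalerA divfK ?natr_neq0.
Qed.

(** * The subalgebra generated by the first [r] variables and [c] *)

Section Subalgebra.
Variables (n r : nat) (le_rn : (r <= n)%N) (c : {mpoly k[n]}).

(** In the application the first [r] variables are central elements of the Lie algebra and [c] is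
    its Casimir element. *)
Definition gens (j : 'I_r.+1) : {mpoly k[n]} :=
  if unlift ord_max j is Some j' then 'X_(widen_ord le_rn j') else c.

Definition gens_eval : {mpoly k[r.+1]} -> {mpoly k[n]} :=
  comp_mpoly [tuple gens j | j < r.+1].
HB.instance Definition _ := GRing.LRMorphism.on gens_eval.

Lemma gens_evalX j : gens_eval 'X_j = gens j.
Proof. exact: comp_mpolyXE. Qed.

Lemma mderiv_gens_eval q i : (gens_eval q)^`M(i) =
  gens_eval q^`M(ord_max) * c^`M(i) +
  \sum_(j < r) gens_eval q^`M(lift ord_max j) * (j == i :> nat)%:R.
Proof.
rewrite (chain_rule (D := mderiv i) gens_eval q (mderivM i)).
rewrite (bigD1_ord ord_max) //=; congr (_ * _^`M(_) + _).
  by rewrite gens_evalX /gens unlift_none.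
apply: eq_bigr => j _; rewrite gens_evalX /gens liftK mderivXU.
by congr (_ * _%:R).
Qed.

(** Differentiating a relation along [i0], where only [c] contributes, and then along the first [r]
    variables shows that its partial derivatives are smaller relations. By induction they vanish, so
    the relation is constant, hence zero. *)
Lemma gens_eval_inj (i0 : 'I_n) : (r <= i0)%N -> c^`M(i0) != 0 -> injective gens_eval.
Proof.
move=> le_ri0 c0; suff inj0 q : gens_eval q = 0 -> q = 0.
  by move=> p q E; apply/subr0_eq/inj0; rewrite rmorphB /= E subrr.
have [d] := ubnP (msize q); elim: d => // d IHd in q *; rewrite ltnS => le_qd q0.
have IHderiv j : gens_eval q^`M(j) = 0 -> q^`M(j) = 0.
  have [-> //|nz] := eqVneq q^`M(j) 0.
  by apply: IHd; apply: leq_trans (msize_mderiv nz) le_qd.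
have q0max : q^`M(ord_max) = 0.
  apply: IHderiv; have := mderiv_gens_eval q i0.
  rewrite q0 mderiv0 big1 => [/esym/eqP|j _].
    by rewrite addr0 mulf_eq0 (negPf c0) orbF => /eqP.
  by rewrite ltn_eqF ?mulr0 // (leq_trans (ltn_ord j)).
have q0j j : q^`M(lift ord_max j) = 0.
  apply: IHderiv; have := mderiv_gens_eval q (widen_ord le_rn j).
  rewrite q0 mderiv0 q0max rmorph0 mul0r add0r (bigD1 j) //= eqxx mulr1 big1 ?addr0 //.
  by move=> i /negPf ij; rewrite (inj_eq val_inj) ij mulr0.
have : forall j, q^`M(j) = 0 by move=> j; case: (unliftP ord_max j) => [j'|] ->.
move=> /mderiv_eq0_const E; move: q0; rewrite E lrmorph_mpolyC.
move/eqP; rewrite scaler_eq0 oner_eq0 orbF => /eqP ->.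
by rewrite mpolyC0.
Qed.

(** In characteristic zero the vanishing derivatives exclude the variables of index at least [r]
    from every monomial of [f]. *)
Lemma gens_eval_ex_poly f :
  (forall i : 'I_n, (r <= i)%N -> f^`M(i) = 0) -> exists q, gens_eval q = f.
Proof.
move=> f0; rewrite [f]mpolyE big_seq.
apply: (big_ind (fun p => exists q, gens_eval q = p)) => [|_ _ [p <-] [q <-]|m].
- by exists 0; rewrite rmorph0.
- by exists (p + q); rewrite rmorphD.
rewrite mcoeff_msupp => fm; rewrite mpolyXE_id.
suff [q <-] : exists q, gens_eval q = \prod_(i < n) 'X_i ^+ m i :> {mpoly k[n]}.
  by exists (f@_m *: q); rewrite linearZ.
apply: (big_ind (fun p => exists q, gens_eval q = p)) => [|_ _ [p <-] [q <-]|i _].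
- by exists 1; rewrite rmorph1.
- by exists (p * q); rewrite rmorphM.
have [le_ri|lt_ir] := leqP r i.
  exists 1; rewrite rmorph1; suff -> : m i = 0%N by rewrite expr0.
  by apply: contraNeq fm => nz; rewrite (mcoeff_mderiv_eq0 (f0 i le_ri)).
exists ('X_(lift ord_max (Ordinal lt_ir)) ^+ m i).
rewrite rmorphXn /= gens_evalX /gens liftK; congr ('X_ _ ^+ _); exact: val_inj.
Qed.

(* The gradients of f and c being proportional along the last n - r variables,
   the coprimality of two of the linear forms d_i c makes the ratio a
   polynomial h; it inherits the hypothesis on f and has smaller degree. *)
Lemma gens_eval_ex (L : 'I_n -> 'I_n -> k) (i0 j0 : 'I_n) f :
    (forall i, c^`M(i) = linform (L i)) ->
    (r <= i0)%N -> (r <= j0)%N ->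
    (forall s t, (forall l, s * L i0 l + t * L j0 l = 0) -> s = 0 /\ t = 0) ->
    (forall i j : 'I_n, (r <= i)%N -> (r <= j)%N ->
       f^`M(i) * c^`M(j) = f^`M(j) * c^`M(i)) ->
  exists q, gens_eval q = f.
Proof.
move=> cL le_ri0 le_rj0 Lfree.
have c0 : c^`M(i0) != 0.
  apply/eqP; rewrite cL => /linform_eq0 L0.
  have [|/eqP] := Lfree 1 0; last by rewrite oner_eq0.
  by move=> l; rewrite L0 mulr0 mul0r addr0.
have [d] := ubnP (msize f); elim: d => // d IHd in f *; rewrite ltnS => le_fd fc.
have [h hi0] : exists h : {mpoly k[n]}, f^`M(i0) = h * c^`M(i0).
  have:= fc i0 j0 le_ri0 le_rj0; rewrite !cL => /linform_dvd; exact.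
have hE (i : 'I_n) : (r <= i)%N -> f^`M(i) = h * c^`M(i).
  move=> le_ri; apply: (mulIf c0); rewrite -mulrAC -hi0.
  by rewrite (fc i i0) // mulrC.
have [q Eq] : exists q, gens_eval q = h.
  have [->|h0] := eqVneq h 0; first by exists 0; rewrite rmorph0.
  apply: IHd => [|i j ri rj].
    apply: leq_trans le_fd; apply: leq_ltn_trans (msize_mderiv (i := i0) _).
      rewrite hi0 msizeM // (mpolySpred _ c0) addnS /= leq_addr //.
    by rewrite hi0 mulf_neq0.
  (* The mixed derivatives of [f] agree, and the second derivatives of [c] cancel from this
     identity. *)
  have := mderiv_comm i j f; rewrite !hE // !mderivM mderiv_comm => /addIr.
  by rewrite mulrC.
(* By the chain rule [gens_eval Q] has the same derivatives as [f] from index [r] on, so the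
   difference involves the first [r] variables only. *)
have [Q EQ] := mpoly_antideriv ord_max q.
have [|q' Eq'] := @gens_eval_ex_poly (f - gens_eval Q).
  move=> i le_ri; rewrite mderivB mderiv_gens_eval EQ Eq hE // big1 ?addr0 ?subrr //.
  by move=> j _; rewrite ltn_eqF ?mulr0 // (leq_trans (ltn_ord j)).
by exists (q' + Q); rewrite rmorphD /= Eq' subrK.
Qed.

End Subalgebra.
End Polynomials.

(** * Matrix rank under specialization, and vectors in a small kernel *)

Section Rank.

Lemma mxrank_mxsub (F : fieldType) m n m' n' (f : 'I_m' -> 'I_m) (h : 'I_n' -> 'I_n)
    (A : 'M[F]_(m, n)) : (\rank (mxsub f h A) <= \rank A)%N.
Proof.
rewrite mxsubrc; apply: leq_trans (mxrankS (rowsub_sub _ _)) _.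
by rewrite -mxrank_tr trmx_mxsub -(mxrank_tr A) mxrankS ?rowsub_sub.
Qed.

(** A nonzero minor of maximal size under [f2] is the image of a determinant over [R]; that
    determinant is nonzero and stays so under the injective [f1]. *)
Lemma mxrank_specialize (R : comNzRingType) (F1 F2 : fieldType)
    (f1 : {rmorphism R -> F1}) (f2 : {rmorphism R -> F2}) m n (A : 'M[R]_(m, n)) :
  injective f1 -> (\rank (map_mx f2 A) <= \rank (map_mx f1 A))%N.
Proof.
move=> f1_inj; set B := map_mx f2 A.
have fullB : row_full (rowsub (maxrankfun B) B)^T.
  by rewrite /row_full mxrank_tr; apply: maxrowsub_free.
have := fullrowsub_unit fullB; set h := fullrankfun _; set l := maxrankfun _.
have -> : rowsub h (rowsub l B)^T = (map_mx f2 (mxsub l h A))^T.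
  by apply/matrixP=> i j; rewrite !mxE.
rewrite unitmx_tr unitmxE det_map_mx unitfE => nz.
have U : mxsub l h (map_mx f1 A) \in unitmx.
  rewrite -map_mxsub unitmxE det_map_mx unitfE.
  rewrite (raddf_eq0 _ f1_inj); apply: contraNneq nz => ->; by rewrite rmorph0.
apply: leq_trans (mxrank_mxsub l h _).
by rewrite mxrank_unit.
Qed.

(** The left kernel of [M^T] has dimension at most [r + 1] and contains the first [r] coordinate
    vectors. A nonzero minor would make these, [x] and [y] into [r + 2] independent vectors of
    it. *)
Lemma corank_minor (F : fieldType) m n r (M : 'M[F]_(m, n)) (x y : 'rV[F]_n) :
    (r <= n)%N -> (n <= r.+1 + \rank M)%N ->
    (forall i (j : 'I_n), (j < r)%N -> M i j = 0) ->
    x *m M^T = 0 -> y *m M^T = 0 ->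
  forall i j : 'I_n, (r <= i)%N -> (r <= j)%N -> x 0 i * y 0 j = x 0 j * y 0 i.
Proof.
move=> le_rn rankM M0 xM yM i j le_ri le_rj; apply/eqP; rewrite -subr_eq0.
apply/negPn/negP=> minor.
pose N : 'M_(r + (1 + 1), n) := col_mx (pid_mx r) (col_mx x y).
have NM : N *m M^T = 0.
  rewrite !mul_col_mx xM yM (_ : pid_mx r *m M^T = 0) ?col_mx0 //.
  apply/matrixP=> a l; rewrite !mxE big1 // => s _; rewrite !mxE.
  case: eqP => [E|_]; last by rewrite mul0r.
  by rewrite M0 ?mulr0 -?E.
have : (N <= kermx M^T)%MS by apply/sub_kermxP.
move/mxrankS; rewrite mxrank_ker mxrank_tr leqNgt => /negP; apply.
have /eqnP -> : row_free N; last first.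
  by rewrite addn1 addn2 ltnS leq_subLR addnC.
apply: inj_row_free => v; rewrite -[v]hsubmxK -[rsubmx v]hsubmxK.
move: (lsubmx (rsubmx v)) (rsubmx (rsubmx v)) (lsubmx v) => s t a E.
have Nl l : (a *m (pid_mx r : 'M_(r, n))) 0 l + (s 0 0 * x 0 l + t 0 0 * y 0 l) = 0.
  have /rowP/(_ l) := E; rewrite !mul_row_col [LHS]mxE [RHS]mxE => El.
  by rewrite -[RHS]El; congr (_ + _); rewrite [RHS]mxE; congr (_ + _); rewrite [RHS]mxE big_ord1.
have pid_l (l : 'I_n) : (r <= l)%N -> (a *m (pid_mx r : 'M_(r, n))) 0 l = 0.
  move=> le_rl; rewrite mxE big1 // => z _; rewrite mxE.
  by rewrite ltn_eqF ?mulr0 // (leq_trans (ltn_ord z)).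
have Ni := Nl i; have Nj := Nl j; rewrite !pid_l // !add0r in Ni Nj.
(* Cramer's rule for the two equations [Ni] and [Nj]. *)
have s0 : s 0 0 = 0.
  apply: (mulIf minor); rewrite mul0r.
  transitivity ((s 0 0 * x 0 i + t 0 0 * y 0 i) * y 0 j
    - (s 0 0 * x 0 j + t 0 0 * y 0 j) * y 0 i); first by ring.
  by rewrite Ni Nj !mul0r subrr.
have t0 : t 0 0 = 0.
  apply: (mulIf minor); rewrite mul0r.
  transitivity ((s 0 0 * x 0 j + t 0 0 * y 0 j) * x 0 i
    - (s 0 0 * x 0 i + t 0 0 * y 0 i) * x 0 j); first by ring.
  by rewrite Ni Nj !mul0r subrr.
have -> : s = 0 by apply/rowP=> z; rewrite ord1 s0 mxE.
have -> : t = 0 by apply/rowP=> z; rewrite ord1 t0 mxE.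
suff -> : a = 0 by rewrite !row_mx0.
apply/rowP=> z; have := Nl (widen_ord le_rn z).
rewrite s0 t0 !mul0r !addr0 !mxE (bigD1 z) //= mxE eqxx ltn_ord mulr1 big1 ?addr0 //.
by move=> w /negPf wz; rewrite mxE (inj_eq val_inj) wz mulr0.
Qed.

End Rank.

(** * Lie algebras with a nondegenerate invariant form *)

Section QuadraticLie.
Variables (k : fieldType) (g : lieAlgType k).
Hypothesis char0 : [pchar k] =i pred0.

HB.instance Definition _ x := GRing.isLinear.Build k {mpoly k[\dim {:g}]}
  {mpoly k[\dim {:g}]} *:%R (@sym_ad k g x) (sym_ad_is_linear x).

Lemma lie_anti (x y : g) : lie x y = - lie y x.
Proof.
apply/eqP; rewrite -addr_eq0; apply/eqP.
have := liexx (x + y); rewrite linearDl !linearDr /= !liexx add0r addr0.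
by rewrite addrC.
Qed.

Variable b : {symmetric g}.
Hypothesis bnd : nondegenerate b.
Hypothesis binv : forall x y z, b (lie x y) z = b x (lie y z).

Lemma formC x y : b x y = b y x.
Proof. by rewrite hermC /= expr0 mul1r. Qed.

Lemma form_lie_anti x y z : b y (lie x z) = - b z (lie x y).
Proof. by rewrite -binv formC (lie_anti y) linearNr. Qed.

Lemma form_eq0 x : (forall y, b x y = 0) -> x = 0.
Proof.
move: bnd => /eqP rad0 x0; apply/eqP; rewrite -memv0 -rad0.
by apply/mem_orthovP=> y _.
Qed.

Lemma form_basis_eq0 n (u : n.-tuple g) x :
  basis_of {:g} u -> (forall i : 'I_n, b u`_i x = 0) -> x = 0.
Proof.
move=> bu x0; apply: form_eq0 => y; rewrite formC.
rewrite [y](coord_basis bu (memvf y)) linear_sumlz big1 // => i _.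
by rewrite linearZl_LR /= x0 mulr0.
Qed.

(** A row killed by the Gram matrix of [u] gives an element of the radical. So this matrix is
    invertible, and its inverse expresses the dual basis in terms of [u]. *)
Lemma dual_basis n (u : n.-tuple g) : basis_of {:g} u ->
  exists e : 'I_n -> g, (forall i j : 'I_n, b u`_i (e j) = (i == j)%:R)
    /\ (forall x, x = \sum_(i < n) b u`_i x *: e i).
Proof.
move=> bu; pose G : 'M[k]_n := \matrix_(i, j) b u`_i u`_j.
have fu : free u := basis_free bu.
have Gunit : G \in unitmx.
  rewrite -row_free_unit; apply: inj_row_free => v vG.
  have v0 : \sum_i v 0 i *: u`_i = 0.
    apply: (form_basis_eq0 bu) => j; rewrite formC linear_sumlz.
    have /rowP/(_ j) := vG; rewrite !mxE => vGj; rewrite -[RHS]vGj; apply: eq_bigr => i _.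
    by rewrite linearZl_LR mxE.
  apply/rowP=> i; rewrite mxE.
  by move/freeP: fu => /(_ (fun i => v 0 i) v0).
pose e i := \sum_j invmx G i j *: u`_j.
have ue (i j : 'I_n) : b u`_i (e j) = (i == j)%:R.
  have /matrixP/(_ j i) := mulVmx Gunit; rewrite !mxE eq_sym => <-.
  rewrite linear_sumr; apply: eq_bigr => l _.
  by rewrite linearZr_LR mxE formC.
exists e; split=> // x; apply/eqP; rewrite -subr_eq0; apply/eqP.
apply: (form_basis_eq0 bu) => i; rewrite linearBr /= linear_sumr (bigD1 i) //=.
rewrite linearZr_LR /= ue eqxx mulr1 big1 ?addr0 ?subrr // => j /negPf ji.
by rewrite linearZr_LR /= ue eq_sym ji mulr0.
Qed.

(** * Invariants in dual coordinates, and the Casimir element *)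

Section DualBases.
Local Notation n := (\dim {:g}).
Local Notation Sg := {mpoly k[n]}.
Variables u e : 'I_n -> g.
Hypothesis ue : forall i j, b (u i) (e j) = (i == j)%:R.
Hypothesis coordE : forall x, x = \sum_i b (u i) x *: e i.

(* S(g) in the variables e_j instead of vbasis {:g}; from_e changes back. *)
Definition to_e (x : g) : Sg := linform (fun i => b (u i) x).

Definition from_e : Sg -> Sg := comp_mpoly [tuple sym_inj (e j) | j < n].
HB.instance Definition _ := GRing.LRMorphism.on from_e.

Lemma to_e_is_linear : linear to_e.
Proof.
move=> a x y; rewrite /to_e /linform scaler_sumr -big_split; apply: eq_bigr => i _.
by rewrite linearPr /= scalerDl scalerA.
Qed.
HB.instance Definition _ :=
  GRing.isLinear.Build k g Sg *:%R to_e to_e_is_linear.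

Lemma to_e_e j : to_e (e j) = 'X_j.
Proof.
rewrite /to_e /linform (bigD1 j) //= ue eqxx scale1r big1 ?addr0 // => i /negPf ij.
by rewrite ue ij scale0r.
Qed.

Lemma from_e_to_e x : from_e (to_e x) = sym_inj x.
Proof.
rewrite /from_e comp_linform [in RHS](coordE x) linear_sum; apply: eq_bigr => i _.
by rewrite tnth_mktuple linearZ.
Qed.

(** Replacing the variables by [to_e] of the original basis is a left inverse, as is checked on the
    variables. *)
Lemma from_e_inj : injective from_e.
Proof.
pose f : Sg -> Sg := comp_mpoly [tuple to_e (vbasis {:g})`_i | i < n].
suff fK : cancel from_e f by apply: can_inj fK.
have fE x : f (sym_inj x) = to_e x.
  rewrite /f comp_linform [in RHS](coord_vbasis (memvf x)) linear_sum.
  by apply: eq_bigr => i _; rewrite tnth_mktuple linearZ.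
apply: (eq_lrmorph (phi := f \o from_e) (psi := idfun)) => j.
by change (f (from_e 'X_j) = 'X_j); rewrite -to_e_e from_e_to_e fE.
Qed.

Lemma from_e_surj p : exists q, from_e q = p.
Proof.
elim/mpoly_ring_ind: p => [c|i|_ _ [p <-] [q <-]|_ _ [p <-] [q <-]].
- by exists c%:MP; rewrite /from_e comp_mpolyC.
- by exists (to_e (vbasis {:g})`_i); rewrite from_e_to_e sym_inj_basis.
- by exists (p + q); rewrite rmorphD.
by exists (p * q); rewrite rmorphM.
Qed.

Lemma sym_ad_from_e x q :
  sym_ad x (from_e q) = from_e (\sum_j q^`M(j) * to_e (lie x (e j))).
Proof.
rewrite (chain_rule (D := sym_ad x) from_e q (sym_adM x)) rmorph_sum.
apply: eq_bigr => j _; rewrite rmorphM /= from_e_to_e; congr (_ * _).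
by rewrite -to_e_e from_e_to_e sym_ad_inj.
Qed.

Lemma sym_invariant_from_e q : sym_invariant (from_e q) <->
  forall x, \sum_j q^`M(j) * to_e (lie x (e j)) = 0.
Proof.
split=> inv x; last by rewrite sym_ad_from_e inv rmorph0.
by apply: from_e_inj; rewrite rmorph0 -sym_ad_from_e inv.
Qed.

(** As ['X_i] stands for [e i], this is the symmetric Casimir element, the sum of the products
    [e_i u_i] of dual basis vectors. *)
Definition casimir : Sg := \sum_i 'X_i * to_e (u i).

(** The product rule yields [u i] twice, the second time by symmetry of [b]; hence the factor 2. *)
Lemma mderiv_casimir i : casimir^`M(i) = linform (fun l => 2%:R * b (u l) (u i)).
Proof.
have -> : linform (fun l => 2%:R * b (u l) (u i)) = to_e (u i) + to_e (u i).
  rewrite /to_e /linform -big_split; apply: eq_bigr => l _.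
  by rewrite /= -scalerDl mulr_natl mulr2n.
rewrite /casimir linear_sum /= (eq_bigr (fun j : 'I_n =>
    (j == i)%:R * to_e (u j) + b (u i) (u j) *: 'X_j)); last first.
  move=> j _; rewrite mderivM mderivXU; congr (_ + _).
  rewrite /to_e /linform linear_sum (bigD1 i) //= linearZ /= mderivXU eqxx.
  rewrite big1 ?addr0 => [|l /negPf li]; first by rewrite -scalerAr mulr1.
  by rewrite linearZ /= mderivXU li scaler0.
rewrite big_split /=; congr (_ + _).
  rewrite (bigD1 i) //= eqxx mul1r big1 ?addr0 // => j /negPf ->.
  by rewrite mul0r.
by apply: eq_bigr => l _; rewrite formC.
Qed.

(** The action of [x] gives twice a sum [T] that pairs the symmetric products [e_i e_j] with
    coefficients made skew by the invariance of [b], so [T = - T]. *)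
Lemma casimir_invariant : sym_invariant (from_e casimir).
Proof.
apply/sym_invariant_from_e => x; set S := \sum_j _.
pose T := \sum_i \sum_j b (u j) (lie x (u i)) *: ('X_i * 'X_j) : Sg.
have ST : S = 2%:R * T.
  have -> : T = \sum_i 'X_i * to_e (lie x (u i)).
    apply: eq_bigr => i _; rewrite /to_e /linform mulr_sumr.
    by apply: eq_bigr => j _; rewrite -scalerAr.
  rewrite /S (eq_bigr (fun j => \sum_i
      2%:R * ('X_i * to_e (b (u j) (u i) *: lie x (e j))))); last first.
    move=> j _; rewrite mderiv_casimir mulr_suml; apply: eq_bigr => i _.
    rewrite linearZ /= -scalerAr -scalerAl formC -scalerA.
    by rewrite mulr_natl scaler_nat.
  rewrite exchange_big mulr_sumr; apply: eq_bigr => i _ /=.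
  rewrite -!mulr_sumr -linear_sum; congr (_ * (_ * to_e _)).
  rewrite [in RHS](coordE (u i)) linear_sumr; apply: eq_bigr => j _.
  by rewrite linearZr_LR.
suff TN : T = - T.
  have : 2%:R * T = 0.
    by rewrite mulr_natl mulr2n {1}TN addNr.
  by rewrite ST.
rewrite /T [LHS]exchange_big -sumrN; apply: eq_bigr => i _; rewrite -sumrN /=.
apply: eq_bigr => j _; rewrite -scaleNr mulrC; congr (_ *: _).
exact: form_lie_anti.
Qed.

(** The derivatives represent the vectors [2 u_i]; 2 is invertible, and pairing with [e] shows that
    the [u_i] are independent. *)
Lemma mderiv_casimir_free i j s t : i != j ->
    (forall l, s * (2%:R * b (u l) (u i)) + t * (2%:R * b (u l) (u j)) = 0) ->
  s = 0 /\ t = 0.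
Proof.
move=> /negPf ij st0; pose x := s *: u i + t *: u j.
have x0 : x = 0.
  rewrite (coordE x) big1 // => l _; suff -> : b (u l) x = 0 by rewrite scale0r.
  apply: (mulfI (natr_neq0 char0 1)); rewrite mulr0 -[RHS](st0 l) /x.
  rewrite linearDr /= !linearZr_LR /=; ring.
have xE l : s * (i == l)%:R + t * (j == l)%:R = 0.
  have := linear0l b (e l); rewrite -x0 linearDl /= !linearZl_LR /= !ue; exact.
have := xE i; have := xE j.
by rewrite !eqxx ij eq_sym ij !mulr1 !mulr0 addr0 add0r.
Qed.

(** Over the fraction field its kernel contains the gradients of invariants; evaluated at [xi] it
    becomes the matrix of the form [xi [x, y]]. *)
Definition lie_mx : 'M[Sg]_n := \matrix_(i, j) to_e (lie (e i) (e j)).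

(** Evaluation at [xi] cannot raise the rank, and the kernel of the evaluated matrix consists of
    coordinate vectors of elements of [lie_stab xi]. *)
Lemma rank_lie_mx (xi : 'Hom(g, k^o)) :
  (n <= \dim (lie_stab xi) + \rank (map_mx (@tofrac Sg) lie_mx))%N.
Proof.
pose ev := meval (fun i => xi (e i) : k) : Sg -> k.
have evE x : ev (to_e x) = xi x.
  rewrite /ev /to_e /linform [in RHS](coordE x) !linear_sum.
  by apply: eq_bigr => i _; rewrite /= mevalZ mevalXU linearZ.
pose B := map_mx ev lie_mx; set s := lie_stab xi.
have rankB : (\rank B <= \rank (map_mx (@tofrac Sg) lie_mx))%N.
  by apply: mxrank_specialize => p q /eqP; rewrite tofrac_eq => /eqP.
rewrite addnC -leq_subLR; apply: leq_trans (leq_sub2l _ rankB) _.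
rewrite -mxrank_ker.
pose D := \matrix_(a < \dim s, i < n) b (u i) (vbasis s)`_a.
suff /mxrankS kerD : (kermx B <= D)%MS by apply: leq_trans kerD (rank_leq_row _).
apply/row_subP=> l; set v := row l _.
have vB : v *m B = 0 by rewrite -row_mul mulmx_ker row0.
clearbody v; pose x := \sum_i v 0 i *: e i.
have ux i : b (u i) x = v 0 i.
  rewrite linear_sumr (bigD1 i) //= linearZr_LR /= ue eqxx mulr1 big1 ?addr0 //.
  by move=> j /negPf ji; rewrite linearZr_LR /= ue eq_sym ji mulr0.
have xs : x \in s.
  apply/lie_stabP => y; rewrite (coordE y) linear_sumr linear_sum big1 // => j _.
  rewrite linearZr_LR linearZ /= linear_sumlz linear_sum /=.
  have /rowP/(_ j) := vB; rewrite !mxE => vBj.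
  transitivity (b (u j) y *: (0 : k^o)); last by rewrite scaler0.
  congr (_ *: _); rewrite -[RHS]vBj; apply: eq_bigr => i _.
  by rewrite !mxE evE linearZl_LR linearZ.
apply/submxP; exists (\row_a coord (vbasis s) a x); apply/rowP=> i.
rewrite -ux {1}(coord_vbasis xs) linear_sumr !mxE; apply: eq_bigr => a _.
by rewrite !mxE linearZr_LR.
Qed.

(** Invariance under every [e l] says that the gradient is killed by [lie_mx]. The central [e i]
    make its first [r] columns zero, so [corank_minor] applies. *)
Lemma invariant_gradients r (f h : Sg) (xi : 'Hom(g, k^o)) :
    (r <= n)%N -> (\dim (lie_stab xi) <= r.+1)%N ->
    (forall i : 'I_n, (i < r)%N -> forall x, lie x (e i) = 0) ->
    sym_invariant (from_e f) -> sym_invariant (from_e h) ->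
  forall i j : 'I_n, (r <= i)%N -> (r <= j)%N ->
  f^`M(i) * h^`M(j) = f^`M(j) * h^`M(i).
Proof.
move=> le_rn dim_xi central inv_f inv_h i j le_ri le_rj.
pose grad (q : Sg) := \row_i tofrac q^`M(i).
have gradM q : sym_invariant (from_e q) ->
    grad q *m (map_mx (@tofrac Sg) lie_mx)^T = 0.
  move/sym_invariant_from_e=> inv_q; apply/rowP=> l; rewrite !mxE.
  rewrite -[RHS](@tofrac0 Sg) -(inv_q (e l)) rmorph_sum; apply: eq_bigr => m _.
  by rewrite !mxE rmorphM.
apply/eqP; rewrite -tofrac_eq !rmorphM /=; apply/eqP.
have := corank_minor le_rn _ _ (gradM _ inv_f) (gradM _ inv_h) le_ri le_rj.
rewrite !mxE; apply.
  by apply: leq_trans (rank_lie_mx xi) _; rewrite leq_add2r.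
by move=> l m lt_mr; rewrite !mxE central // linear0 rmorph0.
Qed.

Lemma coregular_of_central_dim r (xi : 'Hom(g, k^o)) :
    (r.+1 < n)%N -> (\dim (lie_stab xi) <= r.+1)%N ->
    (forall i : 'I_n, (i < r)%N -> forall x, lie x (e i) = 0) ->
  coregular g.
Proof.
move=> lt_rn dim_xi central.
have le_rn : (r <= n)%N by rewrite ltnW // ltnW.
pose phi := from_e \o gens_eval le_rn casimir.
(* The indices [r] and [r + 1], the first two beyond the central vectors. *)
pose i0 : 'I_n := Ordinal (ltnW lt_rn); pose j0 : 'I_n := Ordinal lt_rn.
have ij0 : i0 != j0 by rewrite -val_eqE /= ltn_eqF.
exists r.+1, phi; split=> [|p].
  apply: inj_comp; first exact: from_e_inj.
  apply: (gens_eval_inj char0 (i0 := i0)) => //.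
  apply/eqP; rewrite mderiv_casimir => /linform_eq0 ci0.
  have [|/eqP] := @mderiv_casimir_free _ _ 1 0 ij0; last by rewrite oner_eq0.
  by move=> l; rewrite ci0 mulr0 mul0r addr0.
split.
  move=> inv_p; have [f fp] := from_e_surj p.
  have [q qf] : exists q, gens_eval le_rn casimir q = f.
    rewrite -fp in inv_p.
    apply: (gens_eval_ex char0 le_rn mderiv_casimir (i0 := i0) (j0 := j0)) => //=.
      by move=> s t; apply: mderiv_casimir_free.
    move=> i j.
    exact: invariant_gradients dim_xi central inv_p casimir_invariant i j.
  by exists q; rewrite /phi /= qf.
(* Conversely, the derivation [sym_ad x] kills each generator. *)
move=> [q <-] x.
rewrite (chain_rule (D := sym_ad x) phi q (sym_adM x)) big1 // => j _.
rewrite /phi /= gens_evalX /gens; case: (unliftP ord_max j) => [j'|] _.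
  by rewrite -to_e_e from_e_to_e sym_ad_inj central ?linear0 ?mulr0 //= ltn_ord.
by rewrite casimir_invariant mulr0.
Qed.

End DualBases.
End QuadraticLie.

(** * The index, the codimension of the derived algebra, and the theorem *)

Section Index.
Variables (k : fieldType) (g : lieAlgType k).

Lemma lie_index_exists : exists xi : 'Hom(g, k^o), \dim (lie_stab xi) = lie_index g.
Proof. by rewrite /lie_index; case: ex_minnP => m /asboolP. Qed.

Lemma lie_index_le (xi : 'Hom(g, k^o)) : (lie_index g <= \dim (lie_stab xi))%N.
Proof.
rewrite /lie_index; case: ex_minnP => m _; apply; apply/asboolP; by exists xi.
Qed.

Lemma lie_index_le_dim : (lie_index g <= \dim {:g})%N.
Proof. by rewrite (leq_trans (lie_index_le 0)) ?dimvS ?subvf. Qed.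

(** Every stabilizer is then the whole space, so all linear forms, coordinates included, vanish on
    brackets. *)
Lemma abelian_of_index (x y : g) : (\dim {:g} <= lie_index g)%N -> lie x y = 0.
Proof.
move=> le_dim; have stabT (xi : 'Hom(g, k^o)) : xi (lie x y) = 0.
  suff : x \in lie_stab xi by move/lie_stabP; apply.
  have /eqP -> : lie_stab xi == fullv.
    by rewrite eqEdim subvf (leq_trans le_dim) ?lie_index_le.
  exact: memvf.
rewrite [lie x y](coord_vbasis (memvf _)) big1 // => i _.
pose f : {linear g -> k^o} := coord (vbasis {:g}) i.
by rewrite -[coord _ _ _](lfunE f) stabT scale0r.
Qed.

Lemma coregular_abelian : (forall x y : g, lie x y = 0) -> coregular g.
Proof.
move=> ab; exists (\dim {:g}), idfun; split=> // p.
split=> [_|_ x]; first by exists p.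
by rewrite /sym_ad big1 // => i _; rewrite ab linear0 mul0r.
Qed.

(** Common form of both cases. Vectors dual to a complement of the derived algebra are orthogonal to
    it, hence central by invariance of [b]. *)
Lemma coregular_quadratic r : [pchar k] =i pred0 -> quadratic g ->
    (r + \dim (lie_prod {:g} {:g}) <= \dim {:g})%N -> lie_index g = r.+1 ->
  coregular g.
Proof.
move=> char0 [b bnd binv]; set D := lie_prod _ _ => codim idx.
have [le_nr|lt_rn] := leqP (\dim {:g}) r.+1.
  by apply: coregular_abelian => x y; rewrite abelian_of_index ?idx.
(* The complement comes first, so that the dual vectors of index below [r] all belong to it. *)
have size_u : size (vbasis D^C ++ vbasis D) == \dim {:g}.
  by rewrite size_cat !size_tuple dimv_compl subnK ?dimvS ?subvf.
pose u := Tuple size_u.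
have bu : basis_of {:g} u.
  have dxD : directv (D^C + D) by apply/directv_addP; rewrite capvC capv_compl.
  by have := cat_basis dxD (vbasisP _) (vbasisP _); rewrite addvC addv_complf.
have [e [ue coordE]] := dual_basis bnd bu.
have [xi dim_xi] := lie_index_exists.
apply: (coregular_of_central_dim char0 binv ue coordE lt_rn (xi := xi)).
  by rewrite dim_xi idx.
move=> i lt_ir x; apply: (form_eq0 bnd) => y; rewrite formC -binv.
have Dyx : lie y x \in D by apply: memv_lie; apply: memvf.
rewrite (coord_vbasis Dyx) linear_sumlz big1 // => j _.
have sDC : (size (vbasis D^C) + j < \dim {:g})%N.
  by rewrite size_tuple dimv_compl -ltn_subRL subKn ?dimvS ?subvf.
rewrite linearZl_LR /=; have -> : (vbasis D)`_j = u`_(Ordinal sDC).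
  by rewrite /= nth_cat ltnNge leq_addr /= addKn.
rewrite ue -val_eqE gtn_eqF ?mulr0 //=.
apply: leq_trans lt_ir _; rewrite size_tuple dimv_compl.
by apply: leq_trans (leq_addr _ _); rewrite leq_subRL ?dimvS ?subvf // addnC.
Qed.

(** In codimension at most one, [g] is spanned by [D] and one vector [x0]; as [[x0, x0] = 0], this
    gives [D <= [g, D]]. So [D] lies in all terms of the lower central series and is zero, which
    contradicts the bound on the dimension. *)
Lemma nilpotent_codim : lie_nilpotent g -> (1 < \dim {:g})%N ->
  (2 + \dim (lie_prod {:g} {:g}) <= \dim {:g})%N.
Proof.
set D := lie_prod _ _ => -[c nil] dim2; rewrite leqNgt; apply/negP=> codim.
(* If [D] is the whole space, [vpick] returns zero and the argument still works. *)
pose x0 := vpick D^C.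
have DC : (D^C <= <[x0]>)%VS.
  have x0D : (<[x0]> <= D^C)%VS by rewrite -memvE memv_pick.
  have [->|nz] := eqVneq (D^C)%VS 0%VS; first exact: sub0v.
  have /eqP -> : <[x0]>%VS == (D^C)%VS; last exact: subvv.
  rewrite eqEdim x0D dim_vline vpick0 nz dimv_compl leq_subLR.
  by rewrite addn1 -ltnS.
have splitE y : exists2 d, d \in D & exists a, y = d + a *: x0.
  have : y \in (D + D^C)%VS by rewrite addv_complf memvf.
  case/memv_addP => d Dd [z /(subvP DC)/vlineP[a ->] ->].
  by exists d => //; exists a.
have stable : (D <= lie_prod {:g} D)%VS.
  apply/lie_prodP=> y z _ _.
  have [d Dd [a ->]] := splitE y; have [d' Dd' [a' ->]] := splitE z.
  rewrite linearDr /= rpredD //; first exact: memv_lie (memvf _) Dd'.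
  rewrite linearZr_LR /= rpredZ // linearDl linearZl_LR /= liexx scaler0 addr0.
  by rewrite lie_anti rpredN; apply: memv_lie (memvf _) Dd.
have {nil}D0 : D = 0%VS.
  apply/eqP; rewrite -subv0 -nil; elim: {nil}c => [|c IHc]; first exact: subvf.
  apply: subv_trans stable _; apply/lie_prodP=> y z gy Dz.
  by apply: memv_lie => //; apply: (subvP IHc).
move: codim dim2; rewrite D0 dimv0 addn0 ltnS => le1 lt1.
by have := leq_trans lt1 le1.
Qed.

End Index.

Theorem theorem52 (k : closedFieldType) (char0 : [pchar k] =i pred0)
    (g : lieAlgType k) (quad : quadratic g) :
  (lie_prod {:g} {:g} <> {:g}%VS /\ lie_index g = 2%N)
    \/ (lie_nilpotent g /\ lie_index g = 3%N) ->
  coregular g.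
Proof.
case=> [[notperf idx]|[nil idx]].
  (* Here [r = 1]: a proper subspace has codimension at least one. *)
  apply: (coregular_quadratic char0 quad _ idx).
  rewrite add1n ltn_neqAle dimvS ?subvf // andbT.
  by apply/eqP=> E; apply/notperf/eqP; rewrite eqEdim subvf E /=.
(* Here [r = 2]; the dimension is at least the index 3, so [nilpotent_codim] applies. *)
apply: (coregular_quadratic char0 quad _ idx).
by apply: nilpotent_codim => //; have := lie_index_le_dim g; rewrite idx => /ltnW.
Qed.
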